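(* Let $R$ be a semiprimitive commutative ring with identity and let $x,y\in R$. Then (a) $h_M(x)=\mathrm{Max}(R)$ if and only if $x=0$. (b) $h_M(x)=\emptyset$ if and only if $x$ is a unit. (c) $h_M(x)^\circ=\emptyset$ if and only if $\mathrm{Ann}(x)=\{0\}$. (d) $h_M(x)\subseteq h_M(y)^\circ$ implies that $y$ is a multiple of $x$.
   Context: $\mathrm{Max}(R)$ is the set of maximal ideals of $R$; for $S\subseteq R$, $h_M(S)=\{M\in\mathrm{Max}(R): S\subseteq M\}$, and $h_M(x)=h_M(\{x\})$. $\mathrm{Max}(R)$ carries the Zariski topology, whose closed sets are the sets $h_M(S)$; $A^\circ$ denotes the interior of $A\subseteq\mathrm{Max}(R)$. $R$ is semiprimitive if the intersection of all its maximal ideals is $\{0\}$. $\mathrm{Ann}(x)=\{r\in R: rx=0\}$. *)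

(* Defs.v *)
From HB Require Import structures.
From mathcomp Require Import all_boot all_order all_algebra.
From mathcomp Require Import all_classical topology.

Set Implicit Arguments.
Unset Strict Implicit.
Unset Printing Implicit Defensive.

Import GRing.Theory.

Local Open Scope classical_set_scope.
Local Open Scope ring_scope.

(* Ideals are [set R] rather than [idealr R], because the latter excludes the
   zero ring (it requires an nzRingType). For the same reason units are defined
   here instead of using [GRing.unit]. *)
Definition is_ideal (R : comPzRingType) (I : set R) : Prop :=
  [/\ I 0,
      forall a b, I a -> I b -> I (a + b)
    & forall r a, I a -> I (r * a)].

Definition is_maximal_ideal (R : comPzRingType) (M : set R) : Prop :=
  [/\ is_ideal M,
      M <> setT
    & forall J : set R, is_ideal J -> M `<=` J -> J = M \/ J = setT].

Record Max (R : comPzRingType) := MaxIdeal {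
  max_set :> set R;
  max_setP : is_maximal_ideal max_set }.

Definition hM (R : comPzRingType) (S : set R) : set (Max R) :=
  [set M : Max R | S `<=` M].

Definition hM1 (R : comPzRingType) (x : R) : set (Max R) := hM [set x].

Definition zariski_open (R : comPzRingType) (U : set (Max R)) : Prop :=
  exists S : set R, ~` U = hM S.

Lemma ideal1 (R : comPzRingType) (I : set R) : is_ideal I -> I 1 -> I = setT.
Proof.
move=> [_ _ Im] I1; apply/seteqP; split=> // r _.
by rewrite -(mulr1 r); exact: Im.
Qed.

Lemma maximal_prime (R : comPzRingType) (M : Max R) (a b : R) :
  max_set M (a * b) -> max_set M a \/ max_set M b.
Proof.
case: M => M [[M0 MD Mm] MT Mmax] /= Mab.
have [Ma|nMa] := pselect (M a); [by left|right].
pose J := [set z | exists m r, M m /\ z = m + r * a].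
have Jid : is_ideal J.
  split.
  - by exists 0, 0; rewrite mul0r addr0.
  - move=> _ _ [m [r [Mm1 ->]]] [n [s [Mn ->]]].
    exists (m + n), (r + s); split; first exact: MD.
    by rewrite mulrDl addrACA.
  - move=> t _ [m [r [Mm1 ->]]]; exists (t * m), (t * r); split; first exact: Mm.
    by rewrite mulrDr mulrA.
have MJ : M `<=` J by move=> m Mm1; exists m, 0; rewrite mul0r addr0.
have Ja : J a by exists 0, 1; rewrite mul1r add0r.
have [JM|JT] := Mmax J Jid MJ; first by rewrite JM in Ja.
have [m [r [Mm1 e1]]] : J 1 by rewrite JT.
rewrite -(mul1r b) e1 mulrDl -mulrA; apply: MD; last exact: Mm.
by rewrite mulrC; exact: Mm.
Qed.

Lemma zariski_openT (R : comPzRingType) : zariski_open (@setT (Max R)).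
Proof.
exists [set 1]; rewrite setCT; apply/seteqP; split=> // M /(_ 1 erefl) M1.
by case: M M1 => M [Mid MT _] /= M1; apply: MT; exact: ideal1.
Qed.

Lemma zariski_openI (R : comPzRingType) (U V : set (Max R)) :
  zariski_open U -> zariski_open V -> zariski_open (U `&` V).
Proof.
move=> [S US] [T VT].
exists [set z | exists s t, [/\ S s, T t & z = s * t]].
rewrite setCI US VT; apply/seteqP; split=> M.
  case: (max_setP M) => -[_ _ Mm] _ _.
  case=> h _ [s [t [Ss Tt ->]]]; last by apply: Mm; exact: h.
  by rewrite mulrC; apply: Mm; exact: h.
move=> h; have [SM|nSM] := pselect (S `<=` M); [by left|right=> t Tt].
have [s Ss nMs] : exists2 s, S s & ~ max_set M s.
  by apply: contrapT => H; apply: nSM => s Ss; apply: contrapT => ?; apply: H; exists s.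
by have /maximal_prime[] : max_set M (s * t) by apply: h; exists s, t.
Qed.

Lemma zariski_open_bigcup (R : comPzRingType) (I : Type) (f : I -> set (Max R)) :
  (forall i, zariski_open (f i)) -> zariski_open (\bigcup_i f i).
Proof.
move=> /choice[S fS]; exists (\bigcup_i S i).
rewrite setC_bigcup; apply/seteqP; split=> M /= h.
  by move=> r [i _ Sr]; have := h i Logic.I; rewrite fS; apply.
by move=> i _; rewrite fS => r Sr; apply: h; exists i.
Qed.

HB.instance Definition _ (R : comPzRingType) := gen_eqMixin (Max R).
HB.instance Definition _ (R : comPzRingType) := gen_choiceMixin (Max R).
HB.instance Definition _ (R : comPzRingType) :=
  isOpenTopological.Build (Max R)
    (@zariski_openT R) (@zariski_openI R) (@zariski_open_bigcup R).

Lemma closed_zariskiE (R : comPzRingType) (A : set (Max R)) :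
  closed A <-> exists S : set R, A = hM S.
Proof.
rewrite -openC; split=> -[S AS]; exists S; last by rewrite setCK.
by rewrite -AS setCK.
Qed.

Definition semiprimitive (R : comPzRingType) : Prop :=
  \bigcap_(M : Max R) (M : set R) = [set 0].

Definition Ann (R : comPzRingType) (x : R) : set R := [set r | r * x = 0].

Definition is_unit (R : comPzRingType) (x : R) : Prop := exists z, x * z = 1.

(* Main.v *)
Require Import Defs.
From mathcomp Require Import all_boot all_order all_algebra.
From mathcomp Require Import all_classical topology.
Import GRing.Theory.
Local Open Scope classical_set_scope.
Local Open Scope ring_scope.

(** In a semiprimitive ring, inclusions between basic Zariski sets translate
    into products being zero. The basic open set where [s] does not vanish lies
    in [hM1 y] exactly when every maximal ideal contains [s] or [y]; as maximal
    ideals are prime and meet in zero, this says [s * y = 0]. The interior of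
    [hM1 y] is the union of the basic open sets that it contains, so it is the
    complement of [hM (Ann y)] ([interior_hM1]).

    This formula gives the last two claims. The interior of [hM1 x] is empty iff
    [Ann x] lies in every maximal ideal, that is, iff [Ann x] is zero. If [hM1 x]
    lies in the interior of [hM1 y], no maximal ideal contains both [x] and
    [Ann y], so by Krull's theorem ([exists_maximal_ideal]) the ideal
    [R x + Ann y] is the whole ring; multiplying [1 = r * x + s], where
    [s * y = 0], by [y] yields [y = y * r * x].

    The first claim is semiprimitivity itself, and the second is Krull's theorem
    for the principal ideal [R x]. *)

(** * Ideals and Krull's theorem *)

Lemma max_ideal {R : comPzRingType} (M : Max R) : is_ideal M.
Proof. by case: (max_setP M). Qed.

Lemma max_proper {R : comPzRingType} (M : Max R) : ~ max_set M 1.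
Proof.
by case: (max_setP M) => Mid MT _ M1; apply: MT; exact: ideal1.
Qed.

Lemma ann_ideal (R : comPzRingType) (x : R) : is_ideal (Ann x).
Proof.
split=> [|a b ax0 bx0|r a ax0]; rewrite /Ann /=.
- exact: mul0r.
- by rewrite mulrDl ax0 bx0 addr0.
- by rewrite -mulrA ax0 mulr0.
Qed.

Definition principal_plus {R : comPzRingType} (x : R) (I : set R) : set R :=
  [set z | exists r s, I s /\ z = r * x + s].

Lemma principal_plus_ideal (R : comPzRingType) (x : R) (I : set R) :
  is_ideal I -> is_ideal (principal_plus x I).
Proof.
move=> [I0 ID IM]; split.
- by exists 0, 0; rewrite mul0r addr0.
- move=> _ _ [r [s [Is ->]]] [r' [s' [Is' ->]]].
  by exists (r + r'), (s + s'); rewrite mulrDl addrACA; split=> //; exact: ID.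
- move=> t _ [r [s [Is ->]]].
  by exists (t * r), (t * s); rewrite mulrDr mulrA; split=> //; exact: IM.
Qed.

(** A directed union of ideals is an ideal, because any two of its elements lie
    in a common member of the family. *)
Lemma bigcup_chain_ideal (R : comPzRingType) (T : Type) (F : set T)
    (f : T -> set R) :
  F !=set0 -> (forall i, F i -> is_ideal (f i)) ->
  (forall i j, F i -> F j -> f i `<=` f j \/ f j `<=` f i) ->
  is_ideal (\bigcup_(i in F) f i).
Proof.
move=> [i Fi] fid Ftot; split.
- by exists i => //; case: (fid i Fi).
- move=> a b [j Fj fja] [k Fk fkb].
  have [jk|kj] := Ftot j k Fj Fk.
  + by exists k => //; case: (fid k Fk) => _ fD _; apply: fD => //; exact: jk.
  + by exists j => //; case: (fid j Fj) => _ fD _; apply: fD => //; exact: kj.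
- move=> r a [j Fj fja]; exists j => //.
  by case: (fid j Fj) => _ _ fM; exact: fM.
Qed.

(** Krull's theorem: properness of an ideal is the condition that it misses [1],
    which passes to unions of chains, so Zorn's lemma applies. *)
Theorem exists_maximal_ideal (R : comPzRingType) (I : set R) :
  is_ideal I -> ~ I 1 -> exists M : Max R, I `<=` M.
Proof.
move=> Iid I1.
(* Zorn's lemma is applied to the sets that become proper ideals once [I] is
   adjoined; in this form the empty chain, whose union is empty, is not an
   exception. *)
pose proper_over J := is_ideal (I `|` J) /\ ~ (I `|` J) 1.
have [F FP Ftot|A [[Aid A1] Amax]] := @Zorn_bigcup R proper_over.
  have [->|/set0P F0] := eqVneq F set0.
    by rewrite bigcup_set0 /proper_over setU0.
  split; last first.
    move=> [//|[J FJ J1]].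
    by case: (FP J FJ) => _; apply; right.
  have -> : I `|` \bigcup_(J in F) J = \bigcup_(J in F) (I `|` J).
    apply/seteqP; split=> r.
    + move=> [Ir|[J FJ Jr]]; last by exists J => //; right.
      by case: F0 => J FJ; exists J => //; left.
    + by move=> [J FJ [Ir|Jr]]; [left|right; exists J].
  apply: bigcup_chain_ideal => // [J /FP[]//|J K FJ FK].
  by case: (Ftot J K FJ FK) => ?; [left|right]; exact: setUS.
suff Mmax : is_maximal_ideal (I `|` A) by exists (MaxIdeal Mmax); left.
split=> // [IAT|J Jid IAJ]; first by apply: A1; rewrite IAT.
have [J1|J1] := pselect (J 1); [by right; exact: ideal1|left].
have IJ : I `|` J = J by apply/setUidPr => r Ir; apply: IAJ; left.
apply/seteqP; split=> // r Jr; apply: contrapT => nIAr.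
apply: (Amax J); last by rewrite /proper_over IJ.
split; first by move=> a Aa; apply: IAJ; right.
by move=> /(_ r Jr) Ar; apply: nIAr; right.
Qed.

(** * Zariski sets *)

Lemma in_hM1 (R : comPzRingType) (x : R) (M : Max R) : hM1 x M <-> max_set M x.
Proof. by split=> [|Mx _ ->//]; apply. Qed.

Lemma hM1_setT (R : comPzRingType) (x : R) :
  semiprimitive R -> hM1 x = [set: Max R] <-> x = 0.
Proof.
move=> hR; split=> [xT|->].
  suff : [set 0] x by [].
  by rewrite -hR => M _; apply/in_hM1; rewrite xT.
by apply/seteqP; split=> // M _; apply/in_hM1; case: (max_ideal M).
Qed.

Lemma hM1_set0 (R : comPzRingType) (x : R) : hM1 x = set0 <-> is_unit x.
Proof.
split=> [x0|[z xz1]]; last first.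
  apply/seteqP; split=> // M /in_hM1 Mx; apply: (max_proper M).
  by case: (max_ideal M) => _ _ MM; rewrite -xz1 mulrC; exact: MM.
have z_ideal : is_ideal [set (0 : R)].
  split=> [//|a b -> ->|r a ->]; first exact: addr0.
  exact: mulr0.
have [[r [s [-> xr1]]]|x1] := pselect (principal_plus x [set 0] 1).
  by exists r; rewrite mulrC xr1 addr0.
have [M xM] := @exists_maximal_ideal _ _ (@principal_plus_ideal _ x _ z_ideal) x1.
suff : hM1 x M by rewrite x0.
by apply/in_hM1/xM; exists 1, 0; rewrite mul1r addr0.
Qed.

Lemma open_nonvanishing (R : comPzRingType) (s : R) : open (~` hM1 s).
Proof. by rewrite openC; apply/closed_zariskiE; exists [set s]. Qed.

(** Primality of maximal ideals turns [s * y] into the union of the two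
    vanishing loci, so [s * y = 0] says that they cover the spectrum. *)
Lemma nonvanishing_sub (R : comPzRingType) (s y : R) :
  semiprimitive R -> ~` hM1 s `<=` hM1 y <-> s * y = 0.
Proof.
move=> hR; split=> [sy|sy0 M nMs]; last first.
  have : max_set M (s * y) by rewrite sy0; case: (max_ideal M).
  by move=> /maximal_prime[/in_hM1//|/in_hM1].
apply/(@hM1_setT _ _ hR)/seteqP; split=> // M _; apply/in_hM1.
case: (max_ideal M) => _ _ MM.
have [/in_hM1 Ms|/sy/in_hM1 My] := pselect (hM1 s M); last exact: MM.
by rewrite mulrC; exact: MM.
Qed.

(** The sets [~` hM1 s] form a base of the topology, and those contained in
    [hM1 y] are the ones with [s] in [Ann y]. *)
Lemma interior_hM1 (R : comPzRingType) (y : R) :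
  semiprimitive R -> (hM1 y)° = ~` hM (Ann y).
Proof.
move=> hR; apply/seteqP; split=> M.
  have /closed_zariskiE[S hS] : closed (~` (hM1 y)°).
    by rewrite closedC; exact: open_interior.
  move=> yM AM; suff : (~` (hM1 y)°) M by [].
  rewrite hS => s Ss; apply: AM.
  apply/(@nonvanishing_sub _ s y hR) => N nNs.
  apply: interior_subset; apply: contrapT => nyN; apply: nNs; apply/in_hM1.
  by have : hM S N by [rewrite -hS]; apply.
move=> nAM; apply: contrapT => nyM; apply: nAM => s sy0.
apply/in_hM1; apply: contrapT => nMs; apply: nyM.
have E := open_subsetE (hM1 y) (@open_nonvanishing _ s).
have /(@nonvanishing_sub _ s y hR) : s * y = 0 by [].
by rewrite E => /(_ M nMs).
Qed.

Lemma interior_hM1_set0 (R : comPzRingType) (x : R) :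
  semiprimitive R -> (hM1 x)° = set0 <-> Ann x = [set 0].
Proof.
move=> hR; rewrite interior_hM1 //; split=> [A0|->]; last first.
  by apply/seteqP; split=> // M; apply=> _ ->; case: (max_ideal M).
have AT : hM (Ann x) = setT by rewrite -[LHS]setCK A0 setC0.
apply/seteqP; split=> [s xs|_ ->]; last exact: mul0r.
by rewrite -hR => M _; have : hM (Ann x) M by [rewrite AT]; apply.
Qed.

Lemma hM1_sub_interior (R : comPzRingType) (x y : R) :
  semiprimitive R -> hM1 x `<=` (hM1 y)° -> exists z : R, y = z * x.
Proof.
move=> hR; rewrite interior_hM1 // => xy.
have [[r [s [sy0 e1]]]|J1] := pselect (principal_plus x (Ann y) 1).
  exists (y * r); rewrite -[LHS]mulr1 e1 mulrDr mulrA [y * s]mulrC.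
  by rewrite [s * y]sy0 addr0.
have Jid := @principal_plus_ideal _ x _ (@ann_ideal _ y).
have [M JM] := @exists_maximal_ideal _ _ Jid J1.
suff /xy : hM1 x M.
  by case=> s sy0; apply: JM; exists 0, s; rewrite mul0r add0r.
apply/in_hM1/JM; exists 1, 0; rewrite mul1r addr0; split=> //.
exact: mul0r.
Qed.

(** * Units, annihilators and multiples read off the maximal spectrum *)

Theorem lemma4p18 (R : comPzRingType) (hR : semiprimitive R) (x y : R) :
  [/\ hM1 x = [set: Max R] <-> x = 0,
      hM1 x = set0 <-> is_unit x,
      (hM1 x)° = set0 <-> Ann x = [set 0]
    & hM1 x `<=` (hM1 y)° -> exists z : R, y = z * x].
Proof.
split.
- exact: hM1_setT.
- exact: hM1_set0.
- exact: interior_hM1_set0.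
- exact: hM1_sub_interior.
Qed.
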